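(* Let $A=\mathrm{Mat}(N,\mathbb{C})$. All nondegenerate unitary solutions $r(u)\in A\otimes A$ of the equation $$r^{12}(-u')r^{13}(u+u')-r^{23}(u+u')r^{12}(u)+r^{13}(u)r^{23}(u')=0$$ have the form $$r(u)=(\phi_a(cu)\otimes\mathrm{id})(P),$$ where $c\in\mathbb{C}^*$, $a\in\mathfrak{sl}_N$, and $\phi_a(u)\in\mathrm{End}(A)$ is the linear operator on $A$ defined from the equation $$u\,\phi_a(u)(X)+[a,\phi_a(u)(X)]=X\qquad (X\in A).$$
   Context: $r(u)$ is a meromorphic $A\otimes A$-valued function in a neighborhood of $0\in\mathbb{C}$; it is nondegenerate if the tensor $r(u)$ is nondegenerate for generic $u$, and unitary if $r^{21}(-u)=-r(u)$, where $r^{21}$ is $r$ with tensor factors exchanged. Here $r^{12}=r\otimes 1\in A\otimes A\otimes A$, and $r^{13},r^{23}$ are defined similarly. $P=\sum_{i,j}e_{ij}\otimes e_{ji}$, where $e_{ij}$ are the matrix units. *)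

(* Defs.v *)
From HB Require Import structures.
From mathcomp Require Import all_boot all_order all_algebra.
From mathcomp Require Import complex mxtens.
From mathcomp Require Import all_classical all_reals all_analysis.

Set Implicit Arguments.
Unset Strict Implicit.
Unset Printing Implicit Defensive.

Import Order.TTheory GRing.Theory Num.Theory.
Import numFieldNormedType.Exports.

Local Open Scope classical_set_scope.
Local Open Scope ring_scope.

(* For A = Mat(N, K), the tensor power A (x) A is realized as 'M_(N * N), and
   A (x) A (x) A as 'M_(N * N * N), through the Kronecker product [*t], which
   is an isomorphism of algebras. *)

Section Tensors.
Variables (K : comNzRingType) (N : nat).
Local Notation A := 'M[K]_N.
Local Notation AA := 'M[K]_(N * N).
Local Notation AAA := 'M[K]_(N * N * N).

Definition tens_coef (t : AA) (i j k l : 'I_N) : K :=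
  t (mxtens_index (i, k)) (mxtens_index (j, l)).

(* The linear map A (x) A -> V induced by a bilinear map f : A x A -> V:
   t is the sum of the [tens_coef t i j k l *: (e_ij *t e_kl)]. *)
Definition tens_lift (V : lmodType K) (f : A -> A -> V) (t : AA) : V :=
  \sum_i \sum_j \sum_k \sum_l
    tens_coef t i j k l *: f (delta_mx i j) (delta_mx k l).

Lemma tens_lift_pure (V : lmodType K) (f : A -> A -> V) (X Y : A) :
    (forall Z, linear (f Z)) -> (forall Z, linear (f ^~ Z)) ->
  tens_lift f (X *t Y) = f X Y.
Proof.
move=> linr linl.
pose fr Z : {linear A -> V} := HB.pack (f Z) (GRing.isLinear.Build _ _ _ _ _ (linr Z)).
pose fl Z : {linear A -> V} := HB.pack (f ^~ Z) (GRing.isLinear.Build _ _ _ _ _ (linl Z)).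
rewrite {2}(matrix_sum_delta X) -[RHS]/(fl Y _) linear_sum.
apply: eq_bigr => i _; rewrite linear_sum; apply: eq_bigr => j _.
rewrite linearZ /= {2}(matrix_sum_delta Y) -[f _ _]/(fr _ _) linear_sum scaler_sumr.
apply: eq_bigr => k _; rewrite linear_sum scaler_sumr.
apply: eq_bigr => l _; rewrite linearZ scalerA; congr (_ *: _).
by rewrite /tens_coef mxE !mxtens_indexK.
Qed.

Definition tens_swap (t : AA) : AA := tens_lift (fun X Y => Y *t X) t.

Definition leg12 (t : AA) : AAA := t *t (1%:M : A).
Definition leg13 (t : AA) : AAA := tens_lift (fun X Y => X *t (1%:M : A) *t Y) t.
Definition leg23 (t : AA) : AAA := tens_lift (fun X Y => (1%:M : A) *t X *t Y) t.

(* The pairing (f, g) |-> (f (x) g)(t) on the dual of A has trivial kernel on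
   each side. *)
Definition nondegenerate_tensor (t : AA) : Prop :=
  (forall f : {scalar A},
     (forall g : {scalar A}, tens_lift (fun X Y => f X * g Y : K^o) t = 0) ->
     forall X, f X = 0) /\
  (forall g : {scalar A},
     (forall f : {scalar A}, tens_lift (fun X Y => f X * g Y : K^o) t = 0) ->
     forall Y, g Y = 0).

Definition tensP : AA := \sum_i \sum_j delta_mx i j *t delta_mx j i.

Definition AYBE (r : K -> AA) (u u' : K) : Prop :=
  leg12 (r (- u')) *m leg13 (r (u + u'))
  - leg23 (r (u + u')) *m leg12 (r u)
  + leg13 (r u) *m leg23 (r u') = 0.

End Tensors.

(* [phi] is the operator phi_a(u); such a [phi] is unique when it exists, being
   a right inverse of an endomorphism of a finite-dimensional space. *)
Definition is_phi (K : fieldType) (N : nat) (a : 'M[K]_N) (u : K)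
    (phi : 'End('M[K]_N)) : Prop :=
  forall X : 'M[K]_N, u *: phi X + (a *m phi X - phi X *m a) = X.

(* Meromorphic functions near 0 are germs: total functions whose value at 0 is
   irrelevant. The neighborhood can be shrunk so that 0 is the only possible
   pole, and then also so that a generic property holds at each u != 0. *)

Definition holomorphic_near0 (K : numFieldType) (m n : nat)
    (g : K -> 'M[K]_(m, n)) : Prop :=
  forall i j, \forall u \near (0 : K), derivable (fun z : K^o => g z i j : K^o) u 1.

Definition meromorphic_near0 (K : numFieldType) (m n : nat)
    (r : K -> 'M[K]_(m, n)) : Prop :=
  exists (d : nat) (g : K -> 'M[K]_(m, n)),
    holomorphic_near0 g /\ \forall u \near (0 : K)^', u ^+ d *: r u = g u.

Definition unitary_near0 (K : numFieldType) (N : nat)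
    (r : K -> 'M[K]_(N * N)) : Prop :=
  \forall u \near (0 : K)^', tens_swap (r (- u)) = - r u.

Definition nondegenerate_near0 (K : numFieldType) (N : nat)
    (r : K -> 'M[K]_(N * N)) : Prop :=
  \forall u \near (0 : K)^', nondegenerate_tensor (r u).

Definition AYBE_near0 (K : numFieldType) (N : nat)
    (r : K -> 'M[K]_(N * N)) : Prop :=
  \forall u \near (0 : K) & u' \near (0 : K),
    u != 0 -> u' != 0 -> u + u' != 0 -> AYBE r u u'.

(* Main.v *)
(* Through the trace pairing, r(u) becomes an operator phi_u on A, invertible by
   nondegeneracy, and with v = -u', w = u + u' unitarity turns the equation into
     phi_v(X) phi_w(Y) = phi_{v+w}(X phi_w(Y) + phi_v(X) Y).
   Hence the inverses D_u of phi_u satisfy D_{v+w}(XY) = D_v(X) Y + X D_w(Y).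
   Taking X = 1 or Y = 1 shows that D_v(1) is a scalar lam(v), additive in v, and
   that D_u - lam(u) is independent of u; it is then a derivation of A, so of the
   form [a, -]. As 1 / lam(u) is an entry of phi_u(1), lam is differentiable at
   small u <> 0, and additivity gives lam(u) = c u; c is not 0 because D_u is
   injective and D_u(1) = lam(u). *)
Require Import Defs.
From HB Require Import structures.
From mathcomp Require Import all_boot all_order all_algebra.
From mathcomp Require Import complex mxtens.
From mathcomp Require Import all_classical all_reals all_analysis.
From mathcomp Require Import ring.

Import Order.TTheory GRing.Theory Num.Theory.
Import numFieldNormedType.Exports.

Local Open Scope classical_set_scope.
Local Open Scope ring_scope.
Local Open Scope complex_scope.

(** * Tensors in A (x) A as operators on A *)

Section TensorOperators.
Set Implicit Arguments.
Unset Strict Implicit.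
Variables (K : fieldType) (N : nat).
Local Notation A := 'M[K]_N.
Implicit Types (t s : 'M[K]_(N * N)) (X Y : A).

(** This is (id (x) tr(- X))(t): a summand Y (x) Z of t sends X to tr(Z X) Y. *)
Definition tens_op t X : A :=
  \matrix_(i, j) \sum_k \sum_l tens_coef t i j k l * X l k.

Fact tens_op_is_linear t : linear (tens_op t).
Proof.
move=> a X Y; apply/matrixP => i j; rewrite !mxE mulr_sumr -big_split /=.
apply: eq_bigr => k _; rewrite mulr_sumr -big_split /=; apply: eq_bigr => l _.
by rewrite !mxE; ring.
Qed.

HB.instance Definition _ t :=
  GRing.isLinear.Build K A A *:%R (tens_op t) (tens_op_is_linear t).

Lemma tens_op_delta t k l i j :
  tens_op t (delta_mx l k) i j = tens_coef t i j k l.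
Proof.
rewrite mxE (bigD1 k) //= (bigD1 l) //= mxE !eqxx mulr1.
rewrite !big1 ?addr0 // => [k' /negPf kk'|l' /negPf ll'].
  by apply: big1 => l' _; rewrite mxE kk' andbF mulr0.
by rewrite mxE ll' mulr0.
Qed.

(** Expands one coefficient into the fourfold sum of [tens_lift], so that entries of lifted tensors
    can be compared term by term. *)
Lemma sum4_delta (F : 'I_N -> 'I_N -> 'I_N -> 'I_N -> K) i j k l :
  \sum_i' \sum_j' \sum_k' \sum_l'
     F i' j' k' l' * ((i == i') && (j == j'))%:R * ((k == k') && (l == l'))%:R
  = F i j k l.
Proof.
rewrite (bigD1 i) //= (bigD1 j) //= (bigD1 k) //= (bigD1 l) //= !eqxx !mulr1.
rewrite !big1 ?addr0 //.
- move=> i' /negPf ii'; rewrite big1 // => j' _; rewrite big1 // => k' _.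
  by rewrite big1 // => l' _; rewrite eq_sym ii' mulr0 mul0r.
- move=> j' /negPf jj'; rewrite big1 // => k' _.
  by rewrite big1 // => l' _; rewrite (eq_sym j) jj' andbF mulr0 mul0r.
- move=> k' /negPf kk'.
  by rewrite big1 // => l' _; rewrite (eq_sym k) kk' mulr0.
- by move=> l' /negPf ll'; rewrite (eq_sym l) ll' andbF mulr0.
Qed.

Lemma tens_swapE t i j k l :
  tens_coef (tens_swap t) i j k l = tens_coef t k l i j.
Proof.
rewrite -[RHS](sum4_delta (tens_coef t)) {1}/tens_coef /tens_swap /tens_lift.
rewrite summxE; apply: eq_bigr => i' _; rewrite summxE; apply: eq_bigr => j' _.
rewrite summxE; apply: eq_bigr => k' _; rewrite summxE; apply: eq_bigr => l' _.
by rewrite mxE tensmxE !mxE; ring.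
Qed.

Lemma leg12E t i j k l m n :
  leg12 t (mxtens_index (mxtens_index (i, k), m))
              (mxtens_index (mxtens_index (j, l), n))
  = tens_coef t i j k l * (m == n)%:R.
Proof. by rewrite tensmxE mxE. Qed.

Lemma leg13E t i j k l m n :
  leg13 t (mxtens_index (mxtens_index (i, k), m))
              (mxtens_index (mxtens_index (j, l), n))
  = tens_coef t i j m n * (k == l)%:R.
Proof.
rewrite -(sum4_delta (tens_coef t)) /leg13 /tens_lift mulr_suml.
rewrite summxE; apply: eq_bigr => i' _; rewrite summxE mulr_suml.
apply: eq_bigr => j' _; rewrite summxE mulr_suml; apply: eq_bigr => k' _.
rewrite summxE mulr_suml; apply: eq_bigr => l' _.
by rewrite mxE !tensmxE !mxE; ring.
Qed.

Lemma leg23E t i j k l m n :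
  leg23 t (mxtens_index (mxtens_index (i, k), m))
              (mxtens_index (mxtens_index (j, l), n))
  = tens_coef t k l m n * (i == j)%:R.
Proof.
rewrite -(sum4_delta (tens_coef t)) /leg23 /tens_lift mulr_suml.
rewrite summxE; apply: eq_bigr => i' _; rewrite summxE mulr_suml.
apply: eq_bigr => j' _; rewrite summxE mulr_suml; apply: eq_bigr => k' _.
rewrite summxE mulr_suml; apply: eq_bigr => l' _.
by rewrite mxE !tensmxE !mxE; ring.
Qed.

Lemma sum_mxtens_index (m n : nat) (F : 'I_(m * n) -> K) :
  \sum_p F p = \sum_i \sum_j F (mxtens_index (i, j)).
Proof.
rewrite pair_big /= (reindex (@mxtens_index m n)) /=.
  by apply: eq_bigr => -[i j].
by exists (@mxtens_unindex m n) => p _; rewrite ?mxtens_indexK ?mxtens_unindexK.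
Qed.

Lemma sum_eq_delta (n : nat) (F : 'I_n -> K) i :
  \sum_p F p * (i == p)%:R = F i.
Proof.
rewrite (bigD1 i) //= eqxx mulr1 big1 ?addr0 // => p /negPf.
by rewrite eq_sym => ->; rewrite mulr0.
Qed.

Lemma AYBE_coef (r : K -> 'M[K]_(N * N)) u u' i j k l m n :
  AYBE r u u' ->
  \sum_p tens_coef (r (- u')) i p k l * tens_coef (r (u + u')) p j m n
  - \sum_p tens_coef (r (u + u')) k p m n * tens_coef (r u) i j p l
  + \sum_p tens_coef (r u) i j m p * tens_coef (r u') k l p n = 0.
Proof.
move/matrixP => /(_ (mxtens_index (mxtens_index (i, k), m))
                    (mxtens_index (mxtens_index (j, l), n))).
rewrite !mxE !sum_mxtens_index => E; rewrite -[RHS]E; congr (_ - _ + _).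
- apply: eq_bigr => p _.
  (* The identity factors of the legs have collapsed two of the three summations of the matrix
     product; they are put back as sums against deltas, here and in the next two terms. *)
  transitivity (\sum_q (\sum_s tens_coef (r (- u')) i p k q *
    tens_coef (r (u + u')) p j s n * (m == s)%:R) * (l == q)%:R).
    by rewrite !sum_eq_delta.
  apply: eq_bigr => q _; rewrite mulr_suml; apply: eq_bigr => s _.
  by rewrite leg12E leg13E (eq_sym l); ring.
- transitivity (\sum_p (\sum_q \sum_s tens_coef (r (u + u')) k q m s *
    tens_coef (r u) p j q l * (n == s)%:R) * (i == p)%:R).
    by rewrite sum_eq_delta; apply: eq_bigr => q _; rewrite sum_eq_delta.
  apply: eq_bigr => p _; rewrite mulr_suml; apply: eq_bigr => q _.
  rewrite mulr_suml; apply: eq_bigr => s _.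
  by rewrite leg23E leg12E (eq_sym n); ring.
- transitivity (\sum_p (\sum_q (\sum_s tens_coef (r u) i p m s *
    tens_coef (r u') q l s n) * (k == q)%:R) * (j == p)%:R).
    by rewrite !sum_eq_delta.
  apply: eq_bigr => p _; rewrite mulr_suml; apply: eq_bigr => q _.
  rewrite !mulr_suml; apply: eq_bigr => s _.
  by rewrite leg13E leg23E (eq_sym j); ring.
Qed.

Lemma eq_bilinear (f g : A -> A -> A) :
    (forall Z, linear (f Z)) -> (forall Z, linear (f ^~ Z)) ->
    (forall Z, linear (g Z)) -> (forall Z, linear (g ^~ Z)) ->
    (forall i j k l, f (delta_mx i j) (delta_mx k l) =
                     g (delta_mx i j) (delta_mx k l)) ->
  forall X Y, f X Y = g X Y.
Proof.
move=> fr fl gr gl E X Y; rewrite -(tens_lift_pure _ _ fr fl).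
rewrite -(tens_lift_pure _ _ gr gl) /tens_lift.
by do 4!apply: eq_bigr => ? _; rewrite E.
Qed.

Lemma mul_delta_mxE X (i j k l : 'I_N) : (delta_mx i j *m X) k l = (k == i)%:R * X j l.
Proof.
rewrite mxE (bigD1 j) //= big1 ?addr0 ?mxE ?eqxx ?andbT // => p /negPf jp.
by rewrite mxE jp andbF mul0r.
Qed.

Lemma mulmx_deltaE X (i j k l : 'I_N) : (X *m delta_mx i j) k l = X k i * (l == j)%:R.
Proof.
rewrite mxE (bigD1 i) //= big1 ?addr0 ?mxE ?eqxx // => p /negPf jp.
by rewrite mxE jp mulr0.
Qed.

(** By bilinearity it is enough to take X = e_lk and Y = e_nm, where the trace pairing picks out
    single coefficients and the claim becomes [AYBE_coef]. Unitarity rewrites r(u') in the third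
    term through r(-u'). *)
Lemma tens_op_AYBE (r : K -> 'M[K]_(N * N)) u u' X Y :
    AYBE r u u' -> tens_swap (r (- u')) = - r u' ->
  tens_op (r (- u')) X *m tens_op (r (u + u')) Y =
  tens_op (r u) (X *m tens_op (r (u + u')) Y + tens_op (r (- u')) X *m Y).
Proof.
move=> aybe unit_r; move: X Y.
apply: eq_bilinear => [Z a X Y|Z a X Y|Z a X Y|Z a X Y|l k n m] /=.
- by rewrite linearP /= mulmxDr -scalemxAr.
- by rewrite linearP /= mulmxDl -scalemxAl.
- rewrite -linearP /=; congr (tens_op _ _).
  by rewrite linearP !mulmxDr -!scalemxAr scalerDr addrACA.
- rewrite -linearP /=; congr (tens_op _ _).
  by rewrite linearP !mulmxDl -!scalemxAl scalerDr addrACA.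
apply/matrixP => i j.
have r21 p q a b : tens_coef (r u') p q a b = - tens_coef (r (- u')) a b p q.
  by rewrite -(tens_swapE (r (- u'))) unit_r /tens_coef mxE opprK.
have := AYBE_coef i j k l m n aybe.
under [X in _ + X = 0]eq_bigr => p _ do rewrite r21 mulrN.
rewrite sumrN -addrA -opprD => /subr0_eq E.
rewrite mxE; under eq_bigr => p _ do rewrite !tens_op_delta.
rewrite {}E linearD mxE; congr (_ + _); rewrite mxE.
- apply: eq_bigr => p _; rewrite -[LHS](sum_eq_delta (fun q =>
    tens_coef (r (u + u')) k p m n * tens_coef (r u) i j p q)).
  apply: eq_bigr => q _.
  by rewrite mul_delta_mxE tens_op_delta (eq_sym l); ring.
- rewrite exchange_big /=; apply: eq_bigr => p _; rewrite -[LHS](sum_eq_delta (fun q =>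
    tens_coef (r u) i j q p * tens_coef (r (- u')) p n k l)).
  apply: eq_bigr => q _.
  by rewrite mulmx_deltaE tens_op_delta (eq_sym m); ring.
Qed.

Lemma mxtrace_mul_delta X (k l : 'I_N) : \tr (X *m delta_mx k l) = X l k.
Proof.
rewrite -[RHS](sum_eq_delta (fun p => X p k)); apply: eq_bigr => p _.
by rewrite mulmx_deltaE eq_sym.
Qed.

(** With g = tr(X -), every f satisfies (f (x) g)(t) = f([tens_op t X]) = 0. Nondegeneracy gives g =
    0, and the values of g on matrix units are the entries of X. *)
Lemma nondegenerate_tens_op_inj t X :
  nondegenerate_tensor t -> tens_op t X = 0 -> X = 0.
Proof.
case=> _ nondeg tX0.
have tr_linear : linear (fun Y => \tr (X *m Y) : K^o).
  by move=> a Y Z; rewrite mulmxDr -scalemxAr mxtraceD mxtraceZ.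
pose g : {scalar A} := HB.pack (fun Y => \tr (X *m Y) : K^o)
  (GRing.isLinear.Build _ _ _ _ _ tr_linear).
apply/matrixP => l k; rewrite mxE -mxtrace_mul_delta.
apply: (nondeg g) => f.
transitivity (f (tens_op t X)); last by rewrite tX0 linear0.
rewrite (matrix_sum_delta (tens_op t X)) linear_sum; apply: eq_bigr => i _.
rewrite linear_sum; apply: eq_bigr => j _.
rewrite linearZ /= mxE /GRing.scale /= mulr_suml; apply: eq_bigr => p _.
by rewrite mulr_suml; apply: eq_bigr => q _; rewrite mxtrace_mul_delta; ring.
Qed.

Lemma tensP_coef i j k l :
  tens_coef (tensP K N) i j k l = ((i == l) && (j == k))%:R.
Proof.
rewrite -mulnb natrM -(sum_eq_delta (fun p => (p == l)%:R * (j == k)%:R)).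
rewrite /tens_coef summxE; apply: eq_bigr => p _.
rewrite summxE -(sum_eq_delta (fun q => (p == l)%:R * (q == k)%:R)) mulr_suml.
apply: eq_bigr => q _; rewrite tensmxE !mxE -!mulnb !natrM.
by rewrite (eq_sym l) (eq_sym k); ring.
Qed.

(** P represents the identity, as the sum of the tr(e_ji X) e_ij is X; hence (f (x) id)(P)
    represents f. *)
Lemma tens_op_lift (f : A -> A) t :
  f =1 tens_op t -> t = tens_lift (fun X Y => f X *t Y) (tensP K N).
Proof.
move=> ft; apply/matrixP => ik jl.
case: (mxtens_indexP ik) => i k; case: (mxtens_indexP jl) => j l.
rewrite -[LHS]/(tens_coef t i j k l) -tens_op_delta -ft.
rewrite -(sum4_delta (fun a b c d => f (delta_mx a b) i j) l k k l).
rewrite summxE; apply: eq_bigr => a _; rewrite summxE; apply: eq_bigr => b _.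
rewrite summxE; apply: eq_bigr => c _; rewrite summxE; apply: eq_bigr => d _.
rewrite mxE tensmxE tensP_coef [delta_mx c d k l]mxE.
have [<-|_] := eqVneq k c; last by rewrite !mulr0.
have [<-|_] := eqVneq l d; last by rewrite !mulr0.
by rewrite (eq_sym a) (eq_sym b); ring.
Qed.

End TensorOperators.

(** * Derivations of a matrix algebra and a Leibniz rule with parameters *)

Section MatrixAlgebra.
Set Implicit Arguments.
Unset Strict Implicit.
Variables (K : numFieldType) (N : nat) (i0 : 'I_N).
Local Notation A := 'M[K]_N.
Implicit Types X Y : A.

Lemma central_mx_scalar (M : A) :
  (forall X, M *m X = X *m M) -> M = (M i0 i0)%:M.
Proof.
move=> cM; apply/matrixP => i j; rewrite mxE.
have /matrixP/(_ i0 j) := cM (delta_mx i0 i).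
by rewrite mulmx_deltaE mul_delta_mxE eqxx mul1r eq_sym mulr_natr => ->.
Qed.

(* If [d X = a X - X a] then [\sum_i d(e_{i i0}) e_{i0 i}] is [a] minus the scalar
   [a i0 i0], which makes it the natural witness. *)
Lemma derivation_mx_inner (d : A -> A) :
    linear d -> (forall X Y, d (X *m Y) = d X *m Y + X *m d Y) ->
  exists2 a, \tr a = 0 & forall X, d X = a *m X - X *m a.
Proof.
move=> d_linear dM.
pose dl : {linear A -> A} := HB.pack d (GRing.isLinear.Build _ _ _ _ _ d_linear).
have dZ k X : d (k *: X) = k *: d X by rewrite -[d _]/(dl _) linearZ.
have dS (F : 'I_N -> A) : d (\sum_k F k) = \sum_k d (F k).
  by rewrite -[d _]/(dl _) linear_sum.
pose b := \sum_i d (delta_mx i i0) *m delta_mx i0 i.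
have bE X : d X = b *m X - X *m b.
  have sum1 : \sum_i delta_mx i i0 *m delta_mx i0 i = 1%:M :> A.
    rewrite mx1_sum_delta; apply: eq_bigr => i _; exact: mul_delta_mx.
  have row0 i : delta_mx i0 i *m X = \sum_k X i k *: (delta_mx i0 k : A).
    apply/matrixP => p q; rewrite mul_delta_mxE summxE.
    under eq_bigr => k _ do rewrite 2!mxE -mulnb natrM mulrCA.
    by rewrite -mulr_sumr sum_eq_delta.
  have col0 i : X *m delta_mx i i0 = \sum_k X k i *: (delta_mx k i0 : A).
    apply/matrixP => p q; rewrite mulmx_deltaE summxE.
    under eq_bigr => k _ do rewrite 2!mxE -mulnb natrM mulrA.
    by rewrite -mulr_suml sum_eq_delta.
  (* The tensor sum of the e_{i i0} (x) e_{i0 i} lets X pass from the right of its second factor to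
     the left of its first. The Leibniz rule on X e_{i i0} then yields d X + X b. *)
  have -> : b *m X = \sum_i d (X *m delta_mx i i0) *m delta_mx i0 i.
    rewrite mulmx_suml; under eq_bigr => i _ do
      rewrite -mulmxA row0 mulmx_sumr.
    rewrite exchange_big; apply: eq_bigr => k _ /=.
    rewrite col0 dS mulmx_suml; apply: eq_bigr => i _.
    by rewrite dZ -scalemxAl -scalemxAr.
  under eq_bigr => i _ do rewrite dM mulmxDl -!mulmxA.
  by rewrite big_split /= -!mulmx_sumr sum1 mulmx1 addrK.
have N0 : N%:R != 0 :> K by rewrite pnatr_eq0 -lt0n (leq_ltn_trans _ (ltn_ord i0)).
(* Removing a scalar from b kills the trace and leaves the commutator unchanged. *)
exists (b - (\tr b / N%:R)%:M) => [|X].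
  by rewrite linearB /= mxtrace_scalar -[X in _ - X]mulr_natr divfK ?subrr.
by rewrite bE mulmxBl mulmxBr scalar_mxC opprB addrA subrK.
Qed.

Variables (D : K -> 'End(A)) (e : K).
Hypothesis e_gt0 : 0 < e.
Let dom (u : K) := (u != 0) && (`|u| < e).
(** [D u] will be the inverse of the operator of r(u), hence the restriction of all three parameters
    to a punctured disc. *)
Hypothesis D_Leibniz : forall v w, dom v -> dom w -> dom (v + w) ->
  forall X Y, D (v + w) (X *m Y) = D v X *m Y + X *m D w Y.
Let lam (u : K) := D u 1%:M i0 i0.

(** Computing D_{v+w}(X) from 1 X and from X 1, with v and w exchanged, gives D_v(1) X = X D_v(1),
    so D_v(1) is central. *)
Lemma Leibniz_one_scalar v : dom v -> D v 1%:M = (lam v)%:M.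
Proof.
move=> dv; apply: central_mx_scalar => X.
have [v0 ve] := andP dv.
(* The choice w = -v/2 keeps w and v + w = v/2 nonzero and in the disc. *)
have dw : dom (- (v / 2)).
  rewrite /dom oppr_eq0 mulf_neq0 ?invr_eq0 ?pnatr_eq0 //= normrN normrM.
  by rewrite normfV normr_nat ltr_pdivrMr // (lt_le_trans ve) // ler_pMr // ler1n.
have dvw : dom (v - v / 2).
  by rewrite [v - _](_ : _ = - - (v / 2)); [rewrite /dom oppr_eq0 normrN|field].
have := D_Leibniz dv dw dvw 1%:M X; rewrite !mul1mx => E.
have := D_Leibniz dw dv; rewrite addrC => /(_ dvw X 1%:M); rewrite !mulmx1 E.
by rewrite addrC => /addrI.
Qed.

Lemma Leibniz_shift v w X : dom v -> dom w -> dom (v + w) ->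
  D (v + w) X = lam v *: X + D w X.
Proof.
move=> dv dw dvw; have := D_Leibniz dv dw dvw 1%:M X.
by rewrite !mul1mx Leibniz_one_scalar // mul_scalar_mx.
Qed.

Lemma Leibniz_lam_add v w : dom v -> dom w -> dom (v + w) ->
  lam (v + w) = lam v + lam w.
Proof.
move=> dv dw dvw; by rewrite {1}/lam Leibniz_shift // !mxE eqxx mulr1.
Qed.

Lemma Leibniz_inner : exists2 a, \tr a = 0 & forall u, u != 0 -> `|u| < e / 2 ->
  forall X, D u X = lam u *: X + (a *m X - X *m a).
Proof.
have dom_e n : dom (e / n.+2%:R).
  rewrite /dom gt_eqF ?divr_gt0 // ger0_norm ?divr_ge0 // ?ltW //.
  by rewrite ltr_pdivrMr // ltr_pMr // ltr1n.
(* Shifting by u and by v both compute D_{u+v}, so D_u - lam(u) agrees with its value d at the base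
   point v = e/2. The bound on u keeps u + v nonzero and in the disc. *)
pose v := e / 2; pose d X := D v X - lam v *: X.
have DE u : u != 0 -> `|u| < v -> forall X, D u X = lam u *: X + d X.
  move=> u0 uv X; have v_gt0 : 0 < v by rewrite divr_gt0.
  have du : dom u.
    rewrite /dom u0 (lt_trans uv) //.
    by rewrite ltr_pdivrMr // ltr_pMr // ltr1n.
  have duv : dom (u + v).
    rewrite /dom; apply/andP; split.
      apply/eqP => /(canRL (addrK _)); rewrite sub0r => uE.
      by move: uv; rewrite uE normrN gtr0_norm // ltxx.
    by rewrite (le_lt_trans (ler_normD _ _)) // [e]splitr (gtr0_norm v_gt0) ltrD2r.
  have := Leibniz_shift X (dom_e 0%N) du; rewrite addrC => /(_ duv).
  by rewrite (Leibniz_shift _ du (dom_e 0%N) duv) /d addrA => ->; rewrite addrC addKr.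
have d_linear : linear d.
  by move=> a X Y; rewrite /d linearP scalerDr scalerBr !scalerA (mulrC a) opprD addrACA.
have dM X Y : d (X *m Y) = d X *m Y + X *m d Y.
  (* Both w and 2w must lie below e/2, where [DE] applies; in the rule at (w, w) the scalar parts
     cancel by additivity of [lam]. *)
  pose w := e / 8.
  have w_gt0 : 0 < w by rewrite divr_gt0.
  have dw : dom w by exact: dom_e.
  have w2 : w + w = e / 4 by rewrite /w; field.
  have dww : dom (w + w) by rewrite w2; exact: dom_e.
  have small x : 0 < x -> x < v -> forall X, D x X = lam x *: X + d X.
    by move=> x0 xv; apply: DE; rewrite ?gt_eqF // gtr0_norm.
  have w2v : w + w < v by rewrite w2 ltr_pM2l // ltf_pV2 ?posrE // ltr_nat.
  have wv : w < v by rewrite (lt_trans _ w2v) // ltrDl.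
  have := D_Leibniz dw dw dww X Y; rewrite !small // ?addr_gt0 //.
  rewrite Leibniz_lam_add // mulmxDl mulmxDr -scalemxAl -scalemxAr addrACA.
  by rewrite scalerDl => /addrI.
have [a a0 dE] := derivation_mx_inner d_linear dM.
by exists a => // u u0 uv X; rewrite -dE; exact: DE.
Qed.

End MatrixAlgebra.

(** * Punctured neighborhoods of 0 and additive differentiable functions *)

Section NearZero.
Set Implicit Arguments.
Unset Strict Implicit.
Variable K : numFieldType.

Lemma near0P (P : K -> Prop) :
  (\forall u \near (0 : K), P u) -> exists2 e, 0 < e & forall u, `|u| < e -> P u.
Proof.
move=> /nbhs_ballP[e /= e0 eP]; exists e => // u ue; apply: eP.
by rewrite -ball_normE /= sub0r normrN.
Qed.

Lemma dnbhs0P (P : K -> Prop) :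
  (\forall u \near (0 : K)^', P u) <->
  exists2 e, 0 < e & forall u, u != 0 -> `|u| < e -> P u.
Proof.
split=> [/nbhs_ballP[e /= e0 eP]|[e e0 eP]].
  exists e => // u u0 ue; apply: eP => //.
  by rewrite -ball_normE /= sub0r normrN.
apply/nbhs_ballP; exists e => //= u; rewrite -ball_normE /= sub0r normrN => ue u0.
exact: eP.
Qed.

Lemma near0_pairP (P : K -> K -> Prop) :
  (\forall u \near (0 : K) & v \near (0 : K), P u v) ->
  exists2 e, 0 < e & forall u v, `|u| < e -> `|v| < e -> P u v.
Proof.
move=> [[S T] /= [/near0P[e e0 eS] /near0P[f f0 fT]] ST].
(* The order of K is partial; positive elements are real, hence comparable. *)
have ef : (e >=< f)%O by rewrite real_comparable ?gtr0_real.
exists (Num.min e f) => [|u v]; first by rewrite /Num.min; case: ifP.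
rewrite !comparable_lt_min // => /andP[ue _] /andP[_ vf].
by apply: (ST (u, v)); split; [exact: eS|exact: fT].
Qed.

(** A dyadic Archimedean property, which a numeric field need not have. *)
Hypothesis halving : forall x y : K, 0 < x -> 0 < y -> exists n, x / 2 ^+ n < y.

(* At a point u0 of differentiability, [(lam (u0 + h) - lam u0) / h = lam h / h]
   has a limit c as h -> 0; this quotient is unchanged by halving h. *)
Lemma additive_derivable_linear (lam F : K -> K) (e u0 : K) :
    0 < e ->
    (forall v w, v != 0 -> `|v| < e -> w != 0 -> `|w| < e ->
       v + w != 0 -> `|v + w| < e -> lam (v + w) = lam v + lam w) ->
    u0 != 0 -> `|u0| < e ->
    (\forall u \near u0, lam u = F u) ->
    derivable (F : K^o -> K^o) u0 1 ->
  exists c, forall h, h != 0 -> `|h| < e -> lam h = c * h.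
Proof.
move=> e0 lamD u00 u0e lamF /cvg_ex[c Fc]; exists c => h h0 he.
have quot k : lam h / h = lam (h / 2 ^+ k) / (h / 2 ^+ k).
  elim: k => [|k ->]; first by rewrite expr0 divr1.
  have dom_k j : (h / 2 ^+ j != 0) && (`|h / 2 ^+ j| < e).
    rewrite mulf_neq0 ?invr_eq0 ?expf_neq0 ?pnatr_eq0 //= normrM normfV.
    rewrite normrX normr_nat (le_lt_trans _ he) //.
    by rewrite ler_pdivrMr ?exprn_gt0 // ler_peMr // exprn_ege1 // ler1n.
  have hk : h / 2 ^+ k = h / 2 ^+ k.+1 + h / 2 ^+ k.+1 by rewrite exprS; field.
  have [[h1 e1] [h2 e2]] := (andP (dom_k k), andP (dom_k k.+1)).
  rewrite {1}hk lamD -?hk // exprS; field.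
  by rewrite h0 expf_neq0 ?pnatr_eq0.
(* Otherwise the quotient would be strictly closer to c near 0 than at h, while some h / 2^n lies
   there with the same quotient. *)
suff /subr0_eq <- : lam h / h - c = 0 by rewrite divfK.
apply/eqP; apply: contraT => neq.
have pos : 0 < `|lam h / h - c| by rewrite normr_gt0.
have /dnbhs0P[d d0 dP] : \forall k \near (0 : K)^', 
    `|lam k / k - c| < `|lam h / h - c|.
  move/cvgrPdist_lt : Fc => /(_ _ pos) Fc.
  have Dlam : \forall k \near (0 : K)^', lam (k + u0) = F (k + u0).
    have [d /= d0 dP] := (nbhs_ballP _ _).1 lamF.
    apply/dnbhs0P; exists d => // k _ kd; apply: dP.
    by rewrite -ball_normE /= opprD addrCA subrr addr0 normrN.
  near=> k.
  have k0 : k != 0 by near: k; exact: nbhs_dnbhs_neq.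
  have ke : `|k| < e by near: k; apply/dnbhs0P; exists e.
  have ku0 : `|k| < `|u0|.
    by near: k; apply/dnbhs0P; exists `|u0|; rewrite ?normr_gt0.
  have kue : `|k + u0| < e.
    near: k; apply/dnbhs0P; exists (e - `|u0|); rewrite ?subr_gt0 // => k _ k_lt.
    by rewrite (le_lt_trans (ler_normD _ _)) // -ltrBrDr.
  have ku : k + u0 != 0.
    by apply: contraTneq ku0 => /(canRL (addrK _)) ->; rewrite sub0r normrN ltxx.
  have lamk : lam k = F (k + u0) - F u0.
    rewrite -(nbhs_singleton lamF); have <- : lam (k + u0) = F (k + u0).
      by near: k.
    by rewrite lamD // addrK.
  rewrite distrC lamk mulrC.
  have : `|c - k^-1 *: ((F \o shift u0) k%:A - F u0)| < `|lam h / h - c|.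
    by near: k.
  by rewrite /= /GRing.scale /= mulr1.
have [|n hn] := halving (x := `|h|) (y := d) _ d0; first by rewrite normr_gt0.
have := dP (h / 2 ^+ n); rewrite -quot ltxx => -> //.
  by rewrite mulf_neq0 ?invr_eq0 ?expf_neq0 ?pnatr_eq0.
by rewrite normrM normfV normrX normr_nat.
Unshelve. all: by end_near.
Qed.

Lemma derivable_quotient (G : K -> K) d (u : K^o) :
  derivable (G : K^o -> K^o) u 1 -> G u != 0 -> 
  derivable (fun v : K^o => v ^+ d / G v : K^o) u 1.
Proof.
move=> dG Gu; apply: (@derivableM K K^o (fun v : K^o => v ^+ d) (fun v : K^o => (G v)^-1)).
  exact: exprn_derivable.
exact: derivableV.
Qed.

End NearZero.

(** Positive complex numbers have zero imaginary part, which reduces the claim to the Archimedean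
    property of R. *)
Lemma complex_halving (R : realType) (x y : R[i]) :
  0 < x -> 0 < y -> exists n, x / 2 ^+ n < y.
Proof.
case: x y => [x xi] [y yi]; rewrite !ltcE /= => /andP[/eqP -> x0] /andP[/eqP -> y0].
have [n xn] : exists n, x / y < 2 ^+ n.
  by exists (Num.bound (x / y)); exact: upper_nthrootP.
exists n.
have -> : (x +i* 0 / 2 ^+ n = (x / 2 ^+ n)%:C)%C.
  by rewrite -[_ +i* _]/(x%:C) rmorphM fmorphV rmorphXn rmorph_nat.
by rewrite ltcR ltr_pdivrMr ?exprn_gt0 // mulrC -ltr_pdivrMr.
Qed.

(** * Classification of the solutions *)

Lemma AYBE_classification (K : numFieldType) (N : nat) (r : K -> 'M[K]_(N * N)) :
  (forall x y : K, 0 < x -> 0 < y -> exists n, x / 2 ^+ n < y) ->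
  (0 < N)%N ->
  meromorphic_near0 r -> nondegenerate_near0 r -> unitary_near0 r ->
  AYBE_near0 r ->
  exists (c : K) (a : 'M[K]_N),
    [/\ c != 0, \tr a = 0 &
      \forall u \near (0 : K)^',
        exists2 phi : 'End('M[K]_N), is_phi a (c * u) phi &
          r u = tens_lift (fun X Y => phi X *t Y) (tensP K N)].
Proof.
move=> halving N0 [d [g [g_holo rg]]] nondeg unit_r /near0_pairP[e1 e1_gt0 aybe].
pose i0 := Ordinal N0.
(* Near 0 this is u^d times the (i0, i0) entry of phi_u(1); as a finite sum of entries of [g] it is
   holomorphic. *)
pose G u := \sum_k g u (mxtens_index (i0, k)) (mxtens_index (i0, k)).
have G_holo : \forall u \near (0 : K), derivable (G : K^o -> K^o) u 1.
  have : \forall u \near (0 : K), forall k : 'I_N, derivable (fun z : K^o =>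
      g z (mxtens_index (i0, k)) (mxtens_index (i0, k)) : K^o) u 1.
    exact: (filter_forall (nbhs_filter (0 : K))
      (fun k => g_holo (mxtens_index (i0, k)) (mxtens_index (i0, k)))).
  apply: filterS => u gu; rewrite (_ : G = \sum_k (fun z : K^o =>
      g z (mxtens_index (i0, k)) (mxtens_index (i0, k)) : K^o)).
    exact: derivable_sum.
  by apply/funext => z; rewrite fct_sumE.
have [e e0 eP] : exists2 e : K, 0 < e & forall u, u != 0 -> `|u| < e ->
    [/\ nondegenerate_tensor (r u), tens_swap (r (- u)) = - r u,
        u ^+ d *: r u = g u, derivable (G : K^o -> K^o) u 1 & `|u| < e1].
  apply/dnbhs0P; near=> u; split; near: u => //.
  - exact: nbhs_dnbhs.
  - by apply/dnbhs0P; exists e1.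
pose phi u : 'End('M[K]_N) := linfun (tens_op (r u)).
have phiE u X : phi u X = tens_op (r u) X by rewrite lfunE.
pose D u := (phi u)^-1%VF.
have phi_inj u : u != 0 -> `|u| < e -> lker (phi u) == 0%VS.
  move=> u0 ue; have [nd _ _ _ _] := eP u u0 ue.
  apply/lker0P; apply: raddf_inj => X phiX0.
  by apply: (nondegenerate_tens_op_inj nd); rewrite -phiE.
have D_Leibniz v w : (v != 0) && (`|v| < e) -> (w != 0) && (`|w| < e) ->
    (v + w != 0) && (`|v + w| < e) ->
    forall X Y, D (v + w) (X *m Y) = D v X *m Y + X *m D w Y.
  move=> /andP[v0 ve] /andP[w0 we] /andP[vw0 vwe] X Y.
  have vwv : v + w - v = w by rewrite addrC addKr.
  have [||_ unit_v _ _ v1] := eP (- v); rewrite ?oppr_eq0 ?normrN //.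
  have [_ _ _ _ vw1] := eP (v + w) vw0 vwe.
  (* The parameters u = v + w and u' = -v give -u' = v and u + u' = w. *)
  have := aybe (v + w) (- v); rewrite normrN oppr_eq0 vwv => /(_ vw1).
  rewrite normrN in v1; move=> /(_ v1 vw0 v0 w0) E.
  have := tens_op_AYBE (D v X) (D w Y) E unit_v.
  rewrite opprK vwv -!phiE !lker0_lfunVK ?phi_inj // => ->.
  by rewrite lker0_lfunK ?phi_inj // addrC.
pose lam u := D u 1%:M i0 i0.
(* Since D_u(1) is the scalar lam(u), applying phi_u gives lam(u) phi_u(1) = 1; the factor u^d
   clears the pole. *)
have lamG u : u != 0 -> `|u| < e -> lam u * G u = u ^+ d.
  move=> u0 ue; have [_ _ gu _ _] := eP u u0 ue.
  have -> : G u = u ^+ d * phi u 1%:M i0 i0.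
    rewrite phiE mxE mulr_sumr; apply: eq_bigr => k _.
    under eq_bigr => l _ do rewrite mxE eq_sym.
    by rewrite sum_eq_delta -gu mxE.
  have := lker0_lfunVK (phi_inj u u0 ue) 1%:M.
  rewrite -/(D u) (Leibniz_one_scalar i0 e0 D_Leibniz) ?u0 // -/(lam u).
  rewrite -[(lam u)%:M]scalemx1 linearZ => /matrixP/(_ i0 i0); rewrite !mxE eqxx /=.
  by rewrite mulrCA => ->; rewrite mulr1.
have lam_quot u : u != 0 -> `|u| < e -> G u != 0 /\ lam u = u ^+ d / G u.
  move=> u0 ue; have E := lamG u u0 ue.
  have Gu : G u != 0.
    by apply/eqP => Gu; move/eqP: E; rewrite Gu mulr0 eq_sym expf_eq0 (negPf u0) andbF.
  by split=> //; rewrite -E mulfK.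
have e2_gt0 : 0 < e / 2 by rewrite divr_gt0.
have e2e : `|e / 2| < e by rewrite gtr0_norm // ltr_pdivrMr // ltr_pMr // ltr1n.
have e20 : e / 2 != 0 by rewrite gt_eqF.
have [c lamc] : exists c, forall h, h != 0 -> `|h| < e -> lam h = c * h.
  have [_ _ _ dG _] := eP _ e20 e2e.
  apply: (additive_derivable_linear halving e0 _ e20 e2e
    (F := fun u => u ^+ d / G u)).
  - move=> v w v0 ve w0 we vw0 vwe.
    by apply: (Leibniz_lam_add i0 e0 D_Leibniz); rewrite ?v0 ?w0 ?vw0.
  (* The ball of radius e/2 around e/2 avoids 0 and stays in the disc. *)
  - apply/nbhs_ballP; exists (e / 2) => //= u; rewrite -ball_normE /= => eu.
    have u0 : u != 0.
      by apply: contraTneq eu => ->; rewrite subr0 gtr0_norm // ltxx.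
    have ue : `|u| < e.
      rewrite -[u](subrK (e / 2)) (le_lt_trans (ler_normD _ _)) //.
      by rewrite distrC (gtr0_norm e2_gt0) [ltRHS]splitr ltrD2r.
    by have [_ ->] := lam_quot u u0 ue.
  - by apply: derivable_quotient => //; have [] := lam_quot _ e20 e2e.
have [a a0 Da] := Leibniz_inner i0 e0 D_Leibniz.
exists c, a; split=> //.
  (* If c = 0, then lam vanishes at e/2, against lam G = u^d there. *)
  apply: contraTneq (expf_neq0 d e20) => c0.
  by rewrite -lamG // lamc // c0 !mul0r eqxx.
apply/dnbhs0P; exists (e / 2) => // u u0 ue2.
have ue : `|u| < e by rewrite (lt_le_trans ue2) // ler_pdivrMr // ler_pMr // ler1n.
exists (phi u) => [X|]; last exact: tens_op_lift.
(* The equation for phi_a(cu) says D_u(phi_u(X)) = X, with D_u = lam(u) + [a, -]. *)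
rewrite -lamc // -[RHS](lker0_lfunK (phi_inj u u0 ue)).
by rewrite -/(D u) Da.
Unshelve. all: by end_near.
Qed.

Theorem proposition1p1 (R : realType) (N : nat) (r : R[i] -> 'M[R[i]]_(N * N)) :
  (0 < N)%N ->
  meromorphic_near0 r ->
  nondegenerate_near0 r ->
  unitary_near0 r ->
  AYBE_near0 r ->
  exists (c : R[i]) (a : 'M[R[i]]_N),
    [/\ c != 0, \tr a = 0 &
      \forall u \near (0 : (R[i] : numFieldType))^',
        exists2 phi : 'End('M[R[i]]_N), is_phi a (c * u) phi &
          r u = tens_lift (fun X Y => phi X *t Y) (tensP R[i] N)].
Proof. exact/AYBE_classification/complex_halving. Qed.
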